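(* Let $P\in\mathbb{F}_{q^r}[X,\sigma]$ be a monic polynomial. Assume $\Psi(P)=Q_1\cdots Q_s$ with $Q_1,\dots,Q_s\in\mathbb{F}_q[Y]$ distinct irreducible monic polynomials (so $\Psi(P)$ is squarefree). Then, for each $1\le i\le s$, $P$ has a unique monic right-divisor $P_i$ such that $\Psi(P_i)=Q_i$. It is given by $P_i=\mathrm{rgcd}(P,Q_i(X^r))$.
   Context: Let $p$ be a prime, $q=p^a$, $r\ge1$, $\sigma(x)=x^q$ on $\mathbb{F}_{q^r}$. $\mathbb{F}_{q^r}[X,\sigma]$ is the skew polynomial ring with $X\cdot c=\sigma(c)\cdot X$ for $c\in\mathbb{F}_{q^r}$. $A$ is a right-divisor of $B$ if $B=UA$ for some skew polynomial $U$; $\mathrm{rgcd}$ denotes the monic right greatest common divisor. For monic $P=X^d-\sum_{i=0}^{d-1}a_iX^i$, let $D_P=\bigoplus_{i=0}^{d-1}\mathbb{F}_{q^r}e_i$ with the $\sigma$-semi-linear map $\varphi$ given by $\varphi(e_i)=e_{i+1}$ for $0\le i\le d-2$ and $\varphi(e_{d-1})=\sum_{i=0}^{d-1}a_ie_i$. Then $\varphi^r$ is $\mathbb{F}_{q^r}$-linear, and $\Psi(P)=\det(Y\,\mathrm{id}-\varphi^r)$, its characteristic polynomial, which lies in $\mathbb{F}_q[Y]$ (commutative polynomials). *)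

(* Defs.v *)
From HB Require Import structures.
From mathcomp Require Import all_boot all_order all_algebra all_field.

Set Implicit Arguments.
Unset Strict Implicit.
Unset Printing Implicit Defensive.

Import GRing.Theory.
Local Open Scope ring_scope.

(* R[X, s]: the additive group of {poly R}, coefficients on the left of the
   powers of X, with the product twisted by X * c = s c * X. *)
Definition skewpoly (R : nzRingType) (s : {rmorphism R -> R}) : Type :=
  {poly R}.

HB.instance Definition _ (R : nzRingType) (s : {rmorphism R -> R}) :=
  GRing.Zmodule.copy (skewpoly s) {poly R}.

Section SkewRing.
Variables (R : nzRingType) (s : {rmorphism R -> R}).
Implicit Types (c : R) (A B C : {poly R}).

(* sum_i b_i X^i |-> sum_i s(b_i) X^(i+1), i.e. left multiplication by X. *)
Definition skew_shift B : {poly R} := map_poly s B * 'X.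

Definition skew_mul (A B : skewpoly s) : skewpoly s :=
  \sum_(i < size (A : {poly R})) (A : {poly R})`_i *: iter i skew_shift B.

Fact skew_shiftD : {morph skew_shift : A B / A + B}.
Proof. by move=> A B; rewrite /skew_shift rmorphD mulrDl. Qed.

Fact skew_shift0 : skew_shift 0 = 0.
Proof. by rewrite /skew_shift rmorph0 mul0r. Qed.

Fact skew_shiftZ c A : skew_shift (c *: A) = s c *: skew_shift A.
Proof. by rewrite /skew_shift map_polyZ -scalerAl. Qed.

Fact skew_mulE n A B : (size A <= n)%N ->
  skew_mul A B = \sum_(i < n) A`_i *: iter i skew_shift B.
Proof.
move=> leAn; rewrite /skew_mul (big_ord_widen n (fun i => A`_i *: iter i skew_shift B)) //.
rewrite big_mkcond; apply: eq_bigr => i _; case: ltnP => // leAi.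
by rewrite nth_default // scale0r.
Qed.

Fact skew_mulDl : left_distributive skew_mul +%R.
Proof.
move=> A B C; set n := maxn (size (A : {poly R})) (size (B : {poly R})).
rewrite (@skew_mulE n (A + B)) ?size_polyD //.
rewrite (@skew_mulE n A) ?leq_maxl // (@skew_mulE n B) ?leq_maxr //.
rewrite -big_split; apply: eq_bigr => i _ /=.
by rewrite coefD scalerDl.
Qed.

Fact iter_skew_shiftD i : {morph iter i skew_shift : A B / A + B}.
Proof. by elim: i => // i IH A B; rewrite !iterS IH skew_shiftD. Qed.

Fact skew_mulDr : right_distributive skew_mul +%R.
Proof.
move=> A B C; rewrite /skew_mul -big_split; apply: eq_bigr => i _ /=.
by rewrite iter_skew_shiftD scalerDr.
Qed.

Fact skew_mul0l B : skew_mul 0 B = 0.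
Proof. by rewrite /skew_mul size_poly0 big_ord0. Qed.

Fact skew_mulZl c A B : skew_mul (c *: A) B = c *: (skew_mul A B : {poly R}).
Proof.
rewrite (@skew_mulE (size A)) ?size_scale_leq // /skew_mul scaler_sumr.
by apply: eq_bigr => i _; rewrite coefZ scalerA.
Qed.

Fact skew_mul_shift A B :
  skew_mul (skew_shift A) B = skew_shift (skew_mul A B).
Proof.
have leTA : (size (skew_shift A) <= (size A).+1)%N.
  by apply: leq_trans (size_polyMleq _ _) _; rewrite size_polyX addn2 ltnS size_poly.
rewrite (skew_mulE _ leTA) big_ord_recl /= coefMX /= scale0r add0r.
rewrite /skew_mul (big_morph _ skew_shiftD skew_shift0); apply: eq_bigr => i _.
by rewrite skew_shiftZ coefMX /= coef_map.
Qed.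

Fact skew_mul_iter i A B :
  skew_mul (iter i skew_shift A) B = iter i skew_shift (skew_mul A B).
Proof. by elim: i => //= i <-; rewrite skew_mul_shift. Qed.

Fact skew_mulA : associative skew_mul.
Proof.
move=> A B C; rewrite {2}/skew_mul.
rewrite (big_morph (skew_mul^~ C) (fun A B => skew_mulDl A B C) (skew_mul0l C)).
by apply: eq_bigr => i _; rewrite skew_mulZl skew_mul_iter.
Qed.

Fact skew_mul1l : left_id (1 : {poly R}) skew_mul.
Proof. by move=> A; rewrite /skew_mul size_poly1 big_ord1 coef1 scale1r. Qed.

Fact iter_skew_shift1 i : iter i skew_shift 1 = 'X^i.
Proof.
elim: i => [|i IH]; first by rewrite expr0.
by rewrite iterS IH /skew_shift map_polyXn exprSr.
Qed.

Fact skew_mul1r : right_id (1 : {poly R}) skew_mul.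
Proof.
move=> A; rewrite /skew_mul -[RHS](@coefK _ A) poly_def.
by apply: eq_bigr => i _; rewrite iter_skew_shift1.
Qed.

HB.instance Definition _ := GRing.Zmodule_isNzRing.Build (skewpoly s)
  skew_mulA skew_mul1l skew_mul1r skew_mulDl skew_mulDr (oner_neq0 {poly R}).

Definition skewC c : skewpoly s := c%:P.
Definition skewX : skewpoly s := 'X.

Fact skewCM c (A : skewpoly s) : skewC c * A = c *: (A : {poly R}).
Proof.
rewrite -[LHS]/(skew_mul _ _) (@skew_mulE 1) ?size_polyC ?leq_b1 //.
by rewrite big_ord1 coefC.
Qed.

Fact skewXM (A : skewpoly s) : skewX * A = skew_shift A.
Proof.
rewrite -[LHS]/(skew_mul _ _) /skew_mul size_polyX big_ord_recl big_ord1.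
by rewrite !coefX scale0r add0r scale1r.
Qed.

Fact skewXC c : skewX * skewC c = skewC (s c) * skewX.
Proof. by rewrite skewXM skewCM /skew_shift map_polyC mul_polyC. Qed.

Fact skewXn i : skewX ^+ i = 'X^i :> {poly R}.
Proof. by elim: i => // i IH; rewrite exprS skewXM IH /skew_shift map_polyXn exprSr. Qed.

(* D_P is the space of row vectors, e_i = delta_mx 0 i, and the rows of
   companionmx P are the images of the e_i (phi_basis_lt, phi_basis_last, with
   P = X^d - sum_i a_i X^i, i.e. a_i = - P`_i). *)
Definition phi (P : skewpoly s) (v : 'rV[R]_(size (P : {poly R})).-1) :
    'rV[R]_(size (P : {poly R})).-1 :=
  map_mx s v *m companionmx (P : {poly R}).

(* The matrix of v |-> phi^r v on row vectors; phi^r is linear when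
   iter r s is the identity (iter_phi_linear), as for frob (iter_frob). *)
Definition Psi (r : nat) (P : skewpoly s) : {poly R} :=
  char_poly (lin1_mx (iter r (@phi P))).

Fact phiD (P : skewpoly s) : {morph @phi P : u v / u + v}.
Proof. by move=> u v; rewrite /phi map_mxD mulmxDl. Qed.

Fact phiZ (P : skewpoly s) c v : @phi P (c *: v) = s c *: phi v.
Proof. by rewrite /phi map_mxZ scalemxAl. Qed.

Fact phi_basis_lt (P : skewpoly s) (i i' : 'I_(size (P : {poly R})).-1) : i' = i.+1 :> nat ->
  @phi P (delta_mx 0 i) = delta_mx 0 i'.
Proof.
move=> def_i'; rewrite /phi map_delta_mx -rowE; apply/rowP=> j.
rewrite !mxE eqxx /= -(inj_eq val_inj) /= def_i' [j == _ :> nat]eq_sym ifN //.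
by rewrite neq_ltn -ltnS prednK -?def_i' ?ltn_ord // (leq_ltn_trans _ (ltn_ord i')).
Qed.

Fact phi_basis_last (P : skewpoly s) (i : 'I_(size (P : {poly R})).-1) :
    i.+1 = (size (P : {poly R})).-1 ->
  @phi P (delta_mx 0 i) = - \sum_(j < _) (P : {poly R})`_j *: delta_mx 0 j.
Proof.
move=> def_i; rewrite /phi map_delta_mx -rowE; apply/rowP=> j.
rewrite !mxE ifT; last by apply/eqP; have:= congr1 predn def_i.
rewrite summxE (bigD1 j) //= !mxE !eqxx mulr1 big1 ?addr0 //.
by move=> k neq_kj; rewrite !mxE eq_sym (negPf neq_kj) andbF mulr0.
Qed.

Fact iter_phi_linear r (P : skewpoly s) : iter r s =1 id -> linear (iter r (@phi P)).
Proof.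
move=> sr1 c u v; rewrite -[c in RHS]sr1.
by elim: r {sr1} => // r IH; rewrite !iterS IH phiD phiZ.
Qed.
End SkewRing.

Definition right_divides (R : nzRingType) (A B : R) := exists U, B = U * A.

(* D is the monic right gcd of A and B; it is unique; over a field it exists
   unless A = B = 0. *)
Definition is_rgcd (R : nzRingType) (s : {rmorphism R -> R})
    (D A B : skewpoly s) :=
  [/\ (D : {poly R}) \is monic, right_divides D A, right_divides D B
    & forall C : skewpoly s,
        right_divides C A -> right_divides C B -> right_divides C D].

Section Frobenius.
Variables (F : finFieldType) (L : fieldExtType F).

(* F plays the role of F_q, so q = #|F|. *)
Definition frob (x : L) : L := x ^+ #|F|.

Fact frobD : {morph frob : x y / x + y}.
Proof.
have [p p_pr pF] := finPcharP F.
have pL : p \in [pchar L].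
  by rewrite inE p_pr -(rmorph_nat (in_alg L)) (pcharf0 pF) rmorph0 /=.
move=> x y; apply: exprDn_pchar; rewrite (eq_pnat _ (pcharf_eq pL)).
by have := finField_is_abelem F; rewrite (card_pprimeChar pF) pnatX pnat_id.
Qed.

Fact frob_zmod : zmod_morphism frob.
Proof.
move=> x y; apply: (addIr (frob y)).
by rewrite -frobD !subrK.
Qed.

Fact frob_monoid : monoid_morphism frob.
Proof. by split=> [|x y]; rewrite /frob ?expr1n ?exprMn. Qed.

HB.instance Definition _ := GRing.isZmodMorphism.Build L L frob frob_zmod.
HB.instance Definition _ := GRing.isMonoidMorphism.Build L L frob frob_monoid.

Fact iter_frob : iter (\dim {:L}) frob =1 id.
Proof.
move=> x; have -> : iter (\dim {:L}) frob x = x ^+ (#|F| ^ \dim {:L}).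
  elim: (\dim _) => [|n IH]; first by rewrite expr1.
  by rewrite iterS IH /frob -exprM expnSr.
by apply/eqP; rewrite -(Fermat's_little_theorem {:L}%AS) memvf.
Qed.

(* Q(X^r), the value of Q at X^r computed in L[X, frob]. *)
Definition skew_subst (Q : {poly F}) (r : nat) : skewpoly frob :=
  (map_poly (fun c : F => skewC frob c%:A) Q).[skewX frob ^+ r].
End Frobenius.
Arguments frob {F} L.

(* Main.v *)
From HB Require Import structures.
Require Import Defs.
From mathcomp Require Import all_boot all_order all_algebra all_field.

Set Implicit Arguments.
Unset Strict Implicit.
Unset Printing Implicit Defensive.

Import GRing.Theory.
Local Open Scope ring_scope.

(* D_P is the quotient of L[X, s] by the left ideal generated by P, and phi^r
   is the action of the central element X^r. Hence Psi is multiplicative;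
   P right-divides N(X^r) for N = Psi P (Cayley-Hamilton); and conversely, if P
   right-divides q(X^r), then Psi P divides a power of q.
   Write Psi P = Q N with Q, N coprime, D = rgcd(P, Q(X^r)) and P = U D. Since
   D is a left combination of P and Q(X^r), N(X^r) D is a left multiple of P,
   so U right-divides N(X^r). Thus Psi D divides a power of Q, Psi U divides a
   power of N, and Psi D * Psi U = Q N forces Psi D = Q. Any other D' with
   Psi D' = Q right-divides Q(X^r), hence D, and has the same degree. *)

(** * Characteristic polynomials and exact sequences *)

Section CharPoly.
Variable K : fieldType.

Lemma linear_mul_lin1 m n (f : 'rV[K]_m -> 'rV[K]_n) (u : 'rV[K]_m) :
  linear f -> u *m lin1_mx f = f u.
Proof.
move=> lf; pose mf := GRing.isLinear.Build K _ _ _ f lf.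
pose g : {linear 'rV[K]_m -> 'rV[K]_n} := HB.pack f mf.
exact: (mul_rV_lin1 g).
Qed.

Lemma horner_mx_sum n (A : 'M[K]_n.+1) (q : {poly K}) (v : 'rV_n.+1) :
  v *m horner_mx A q = \sum_(i < size q) q`_i *: iter i (mulmxr A) v.
Proof.
rewrite -{1}[q]coefK poly_def rmorph_sum mulmx_sumr; apply: eq_bigr => i _.
rewrite /= horner_mxZ rmorphXn /= horner_mx_X -scalemxAr; congr (_ *: _).
elim: (nat_of_ord i) => [|k IH]; first by rewrite expr0 mulmx1.
by rewrite exprSr mulmxA IH.
Qed.

Lemma char_poly_annihilates n (A : 'M[K]_n) (v : 'rV_n) :
  \sum_(i < size (char_poly A)) (char_poly A)`_i *: iter i (mulmxr A) v = 0.
Proof.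
case: n A v => [|n] A v; first by rewrite [LHS]thinmx0.
by rewrite -horner_mx_sum Cayley_Hamilton mulmx0.
Qed.

(* With A constant over K['X], the factor theorem gives
   q(A) - q('X) = B *m ('X - A). *)
Lemma char_poly_dvd_exp n (A : 'M[K]_n) (q : {poly K}) :
    (forall v : 'rV_n, \sum_(i < size q) q`_i *: iter i (mulmxr A) v = 0) ->
  char_poly A %| q ^+ n.
Proof.
case: n A => [|n] A qA0.
  by rewrite /char_poly det_mx00 dvd1p.
have qA : horner_mx A q = 0.
  by apply/row_matrixP => i; rewrite rowE horner_mx_sum qA0 row0.
have [B defB]: exists B : 'M[{poly K}]_n.+1,
    map_mx polyC (horner_mx A q) = q%:M + B *m char_poly_mx A.
  elim/poly_ind: (q) => [|p c [B IH]].
    by exists 0; rewrite rmorph0 map_mx0 mul0mx raddf0 addr0.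
  (* With a the constant matrix of A, p(A) a = p a + B a ('X - a) since a commutes with 'X - a, and
     p a = p 'X - p ('X - a). *)
  exists (B *m map_mx polyC A - p%:M).
  rewrite rmorphD rmorphM /= horner_mx_X horner_mx_C map_mxD.
  rewrite [map_mx _ (_ * A)]map_mxM IH.
  rewrite map_scalar_mx /= [(_ + c%:P)%:M]raddfD /= scalar_mxM /char_poly_mx.
  set a := map_mx polyC A; set X : 'M_n.+1 := 'X%:M.
  have Xa : (X - a) *m a = a *m (X - a) by rewrite mulmxBl mulmxBr scalar_mxC.
  rewrite [LHS]addrC [X in _ + X]mulmxDl -[B *m _ *m a]mulmxA Xa mulmxBl mulmxA (mulmxBr p%:M) opprB.
  rewrite [p%:M *m X + _]addrC -[RHS]addrA; congr (_ + _).
  by rewrite [RHS]addrC -addrA subrK addrC.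
(* As q(A) = 0, the identity becomes [q%:M = - B *m char_poly_mx A]; the exponent of q comes from
   the determinant of the scalar matrix. *)
apply/dvdpP; exists (\det (- B)); rewrite -[RHS]det_mulmx -det_scalar.
congr (\det _); move: defB; rewrite qA map_mx0 => /esym/eqP.
by rewrite addr_eq0 mulNmx => /eqP.
Qed.

Lemma char_poly_similar n (T A B : 'M[K]_n) :
  T \in unitmx -> T *m A = B *m T -> char_poly A = char_poly B.
Proof.
move=> uT eqAB; have uT' : map_mx polyC T \in unitmx.
  by rewrite map_unitmx.
have /(congr1 determinant): map_mx polyC T *m char_poly_mx A
    = char_poly_mx B *m map_mx polyC T.
  by rewrite /char_poly_mx mulmxBr mulmxBl -!map_mxM eqAB scalar_mxC.
rewrite !det_mulmx [RHS]mulrC; apply: mulrI.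
by rewrite -unitmxE.
Qed.

Lemma char_poly_ublock m k (A : 'M[K]_m) (E : 'M_(m, k)) (B : 'M_k) :
  char_poly (block_mx A E 0 B) = char_poly A * char_poly B.
Proof.
rewrite /char_poly -(det_ublock _ (- map_mx polyC E)); congr (\det _).
rewrite /char_poly_mx map_block_mx map_mx0 scalar_mx_block opp_block_mx.
by rewrite add_block_mx oppr0 sub0r addr0.
Qed.

(* Characteristic polynomials are multiplicative along the exact sequence
   0 -> K^k -J-> K^n -H-> K^m -> 0 of modules over K['X]. *)
Lemma char_poly_exact m k n (A : 'M[K]_m) (B : 'M_k) (C : 'M_n)
    (J : 'M_(k, n)) (H : 'M_(n, m)) (S : 'M_(m, n)) :
    n = (m + k)%N -> B *m J = J *m C -> H *m A = C *m H -> S *m H = 1%:M ->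
    row_free J -> J *m H = 0 ->
    (forall v : 'rV_n, v *m H = 0 -> (v <= J)%MS) ->
  char_poly C = char_poly A * char_poly B.
Proof.
move=> def_n; subst n => BJ HA SH freeJ JH kerH.
(* S splits H only K-linearly. Its failure to intertwine A and C is killed by H, so it factors
   through J; this factor is the off-diagonal block of C in the basis formed by S and J. *)
have [E defE]: exists E, S *m C - A *m S = E *m J.
  apply/submxP/row_subP => i; apply: kerH.
  by rewrite -row_mul mulmxBl -!mulmxA -HA SH mulmx1 mulmxA SH mul1mx subrr row0.
rewrite -(char_poly_ublock _ E); apply: (@char_poly_similar _ (col_mx S J)).
  rewrite -row_free_unit -kermx_eq0; apply/rowV0P => v /sub_kermxP.
  rewrite -[v]hsubmxK mul_row_col => vT0.
  have v1: lsubmx v = 0.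
    have := congr1 (mulmx^~ H) vT0.
    by rewrite mulmxDl -!mulmxA SH JH mulmx0 addr0 mulmx1 mul0mx.
  move: vT0; rewrite v1 mul0mx add0r => /eqP.
  by rewrite mulmx_free_eq0 // => /eqP ->; rewrite row_mx0.
by rewrite mul_col_mx mul_block_col mul0mx add0r BJ -defE addrC subrK.
Qed.
End CharPoly.

(** * Euclidean division and Bezout relations for skew polynomials *)

Section SkewEuclid.
Variables (L : fieldType) (s : {rmorphism L -> L}).
Implicit Types (A B D P U V : skewpoly s) (c : L).
Local Notation sz A := (size (A : {poly L})).

Lemma skewpolyE A : A = \sum_(i < sz A) skewC s (A : {poly L})`_i * skewX s ^+ i.
Proof.
rewrite -{1}[A](@coefK _ A) poly_def; apply: eq_bigr => i _.
by rewrite skewCM skewXn.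
Qed.

Lemma skewC_is_zmod_morphism : zmod_morphism (skewC s).
Proof. by move=> x y; rewrite /skewC rmorphB. Qed.

Lemma skewC_is_monoid_morphism : monoid_morphism (skewC s).
Proof. by split=> // x y; rewrite skewCM /skewC polyCM mul_polyC. Qed.

HB.instance Definition _ :=
  GRing.isZmodMorphism.Build L (skewpoly s) (skewC s) skewC_is_zmod_morphism.
HB.instance Definition _ :=
  GRing.isMonoidMorphism.Build L (skewpoly s) (skewC s) skewC_is_monoid_morphism.

Lemma skewXnM i A : skewX s ^+ i * A = iter i (skew_shift s) A.
Proof. by elim: i => [|i IH]; rewrite ?mul1r // exprS -mulrA IH skewXM. Qed.

Lemma iter_skew_shift_monic i D : (D : {poly L}) \is monic ->
  (iter i (skew_shift s) D : {poly L}) \is monic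
  /\ size (iter i (skew_shift s) D : {poly L}) = (sz D + i)%N.
Proof.
move=> mD; elim: i => [|i [mi si]]; first by rewrite addn0.
rewrite iterS /skew_shift; split.
  by rewrite rpredM ?monicX // monic_map.
by rewrite size_mulX ?map_poly_eq0 ?monic_neq0 // size_map_poly si addnS.
Qed.

(** Each X^i D is again monic, since s fixes 1, so the top term of A alone determines size and
    leading coefficient, with no twist by s. *)
Lemma skew_mul_lead A D : (D : {poly L}) \is monic -> A != 0 ->
  size (A * D : {poly L}) = (sz A + sz D).-1
  /\ lead_coef (A * D : {poly L}) = lead_coef (A : {poly L}).
Proof.
move=> mD nzA; have nzl : lead_coef (A : {poly L}) != 0 by rewrite lead_coef_eq0.
rewrite -[A * D]/(skew_mul A D) /skew_mul.
have: (0 < sz A)%N by rewrite size_poly_gt0.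
move: nzl; rewrite /lead_coef; case: (sz A) => // n /= nzl _.
have [mn sn] := iter_skew_shift_monic n mD.
rewrite big_ord_recr /= addrC -!/(lead_coef _).
set t := (X in _ + X); set u := (X in X + _).
have su : size u = (sz D + n)%N by rewrite size_scale.
have lu : lead_coef u = (A : {poly L})`_n by rewrite lead_coefZ (monicP mn) mulr1.
have ltu : (size t < size u)%N.
  rewrite su addnC -(prednK (n := sz D)) ?size_poly_gt0 ?monic_neq0 // addnS ltnS.
  apply: leq_trans (size_sum _ _ _) _.
  apply/bigmax_leqP => i _; apply: leq_trans (size_scale_leq _ _) _.
  have [_ ->] := iter_skew_shift_monic i mD.
  rewrite -{1}(prednK (n := sz D)) ?size_poly_gt0 ?monic_neq0 //.
  by rewrite addSn -addnS addnC leq_add2r.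
by rewrite size_polyDl // lead_coefDl // su lu addnC.
Qed.

Lemma size_skew_mul A D : (D : {poly L}) \is monic -> A != 0 ->
  size (A * D : {poly L}) = (sz A + sz D).-1.
Proof. by move=> mD nzA; have [] := skew_mul_lead mD nzA. Qed.

Lemma monic_skew_mull A D : (D : {poly L}) \is monic ->
  (A * D : {poly L}) \is monic -> (A : {poly L}) \is monic.
Proof.
move=> mD mAD; have nzA: A != 0.
  by apply: contraTneq mAD => ->; rewrite mul0r monicE lead_coef0 eq_sym oner_eq0.
by rewrite monicE -(proj2 (skew_mul_lead mD nzA)) -monicE.
Qed.

Lemma skew_mulIm D : (D : {poly L}) \is monic -> injective (fun A => A * D).
Proof.
move=> mD A B /= eqAB; apply/eqP; rewrite -subr_eq0; apply: contraT => nz.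
have [_ /esym/eqP] := skew_mul_lead mD nz; rewrite mulrBl eqAB subrr lead_coef0.
by rewrite lead_coef_eq0 (negPf nz).
Qed.

Lemma skew_division A P : (P : {poly L}) \is monic ->
  exists U B, A = U * P + B /\ (sz B < sz P)%N.
Proof.
move=> mP; have [n] := ubnP (sz A); elim: n A => // n IH A; rewrite ltnS => leAn.
have [ltAP | lePA] := ltnP (sz A) (sz P).
  by exists 0, A; rewrite mul0r add0r.
(* The monomial M for which M P has the size and leading coefficient of A, so that A - M P is
   shorter. *)
set M := skewC s (lead_coef (A : {poly L})) * skewX s ^+ (sz A - sz P).
have szP : (0 < sz P)%N by rewrite size_poly_gt0 monic_neq0.
have szA : (0 < sz A)%N := leq_trans szP lePA.
have nzA : lead_coef (A : {poly L}) != 0 by rewrite lead_coef_eq0 -size_poly_gt0.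
have [mk sk] := iter_skew_shift_monic (sz A - sz P) mP.
have MP : M * P = lead_coef (A : {poly L}) *:
    (iter (sz A - sz P) (skew_shift s) P : {poly L}).
  by rewrite -mulrA skewCM skewXnM.
have sMP : sz (M * P) = sz A by rewrite MP size_scale // sk subnKC.
have lMP : lead_coef (M * P : {poly L}) = lead_coef (A : {poly L}).
  by rewrite MP lead_coefZ (monicP mk) mulr1.
have [|U [B [defB ltB]]] := IH (A - M * P).
  apply: leq_trans leAn; rewrite -[X in (_ < X)%N]prednK // ltnS.
  apply/leq_sizeP => j; rewrite leq_eqVlt => /predU1P[<-|ltj].
    rewrite coefB; move: lMP; rewrite /lead_coef sMP => ->.
    by rewrite subrr.
  by rewrite coefB !nth_default ?subrr ?sMP // -(prednK szA).
exists (U + M), B; split=> //.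
by rewrite mulrDl addrAC -defB subrK.
Qed.

(** Euclid's algorithm: (P, B) is replaced by (B', C), where B' is B made monic, so that division by
    it is available, and C is the remainder of P. *)
Lemma skew_bezout P B : (P : {poly L}) \is monic ->
  exists D, [/\ (D : {poly L}) \is monic, right_divides D P,
    right_divides D B & exists U V, D = U * P + V * B].
Proof.
have [n] := ubnP (sz B); elim: n B P => // n IH B P; rewrite ltnS => leBn mP.
have [B0 | nzB] := eqVneq B 0.
  exists P; split=> //; first by exists 1; rewrite mul1r.
    by exists 0; rewrite mul0r.
  by exists 1, 0; rewrite mul1r mul0r addr0.
set c := lead_coef (B : {poly L}).
have nzc : c != 0 by rewrite lead_coef_eq0.
pose B' := skewC s c^-1 * B.
have mB' : (B' : {poly L}) \is monic.
  by rewrite monicE /B' skewCM lead_coefZ mulVf.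
have defB : B = skewC s c * B'.
  by rewrite mulrA -rmorphM divff // rmorph1 mul1r.
have [U [C [defP ltC]]] := skew_division P mB'.
have [|D [mD [V defB'] [W defC] [M [N defD]]]] := IH C B' _ mB'.
  by rewrite (leq_trans ltC) // /B' skewCM size_scale ?invr_eq0.
exists D; split=> //.
- by exists (U * V + W); rewrite mulrDl -mulrA -defB' -defC.
- by exists (skewC s c * V); rewrite -mulrA -defB'.
(* Substitute C = P - U B' into D = M B' + N C, then B' = c^-1 B. *)
exists N, ((M - N * U) * skewC s c^-1); rewrite -mulrA -/B' defD.
rewrite defP mulrDr mulrBl [N * (U * _)]mulrA [N * U * B' + _]addrC -[RHS]addrA.
by rewrite (addrC (N * U * B')) subrK addrC.
Qed.
End SkewEuclid.

(** * The module D_P as a quotient, and multiplicativity of [Psi] *)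

Section Action.
Variables (L : fieldType) (s : {rmorphism L -> L}).
Implicit Types (A B D P U V : skewpoly s) (c : L).
Local Notation sz A := (size (A : {poly L})).
Local Notation dim P := (sz P).-1.

Definition skew_act P A (v : 'rV[L]_(dim P)) : 'rV[L]_(dim P) :=
  \sum_(i < sz A) (A : {poly L})`_i *: iter i (@phi _ s P) v.

(* The class of A in D_P, viewed as the quotient of L[X, s] by the left ideal
   generated by P. *)
Definition skew_class P A : 'rV[L]_(dim P) :=
  skew_act A (\row_j (j == 0 :> nat)%:R).

Lemma skew_actE n P A (v : 'rV_(dim P)) : (sz A <= n)%N ->
  skew_act A v = \sum_(i < n) (A : {poly L})`_i *: iter i (@phi _ s P) v.
Proof.
move=> leAn; rewrite /skew_act.
rewrite (big_ord_widen n (fun i => (A : {poly L})`_i *: iter i (@phi _ s P) v)) //.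
rewrite big_mkcond; apply: eq_bigr => i _; case: ltnP => // leAi.
by rewrite nth_default // scale0r.
Qed.

Lemma skew_actDl P A B (v : 'rV_(dim P)) :
  skew_act (A + B) v = skew_act A v + skew_act B v.
Proof.
set n := maxn (sz A) (sz B).
rewrite (@skew_actE n _ (A + B)) ?size_polyD //.
rewrite (@skew_actE n _ A) ?leq_maxl // (@skew_actE n _ B) ?leq_maxr //.
by rewrite -big_split; apply: eq_bigr => i _ /=; rewrite coefD scalerDl.
Qed.

Lemma skew_act0l P (v : 'rV_(dim P)) : skew_act 0 v = 0.
Proof. by rewrite /skew_act size_poly0 big_ord0. Qed.

Lemma skew_actZl P c A (v : 'rV_(dim P)) :
  skew_act (c *: (A : {poly L}) : skewpoly s) v = c *: skew_act A v.
Proof.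
rewrite (@skew_actE (sz A)) ?size_scale_leq // scaler_sumr.
by apply: eq_bigr => i _; rewrite coefZ scalerA.
Qed.

Lemma phi0 P : @phi _ s P 0 = 0.
Proof. by rewrite /phi map_mx0 mul0mx. Qed.

Lemma skew_act_shift P A (v : 'rV_(dim P)) :
  skew_act (skew_shift s A : skewpoly s) v = phi (skew_act A v).
Proof.
have leTA : (size (skew_shift s A) <= (sz A).+1)%N.
  by apply: leq_trans (size_polyMleq _ _) _; rewrite size_polyX addn2 ltnS size_poly.
rewrite (skew_actE _ leTA) big_ord_recl /= coefMX /= scale0r add0r.
rewrite /skew_act (big_morph _ (@phiD _ s P) (phi0 P)); apply: eq_bigr => i _.
by rewrite phiZ coefMX /= coef_map.
Qed.

Lemma skew_actM P A B (v : 'rV_(dim P)) :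
  skew_act (A * B) v = skew_act A (skew_act B v).
Proof.
rewrite -[A * B]/(skew_mul A B) /skew_mul.
rewrite (big_morph (fun C : skewpoly s => skew_act C v)
  (fun A B => skew_actDl A B v) (skew_act0l v)).
apply: eq_bigr => i _; rewrite skew_actZl; congr (_ *: _).
by elim: (nat_of_ord i) => //= k <-; rewrite skew_act_shift.
Qed.

Lemma skew_actX P (v : 'rV_(dim P)) : skew_act (skewX s) v = phi v.
Proof.
rewrite /skew_act size_polyX big_ord_recl big_ord1.
by rewrite !coefX scale0r add0r scale1r.
Qed.

Lemma skew_act1 P (v : 'rV_(dim P)) : skew_act 1 v = v.
Proof. by rewrite /skew_act size_poly1 big_ord1 coef1 scale1r. Qed.

Lemma skew_actC P c (v : 'rV_(dim P)) : skew_act (skewC s c) v = c *: v.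
Proof.
by rewrite (@skew_actE 1) ?size_polyC ?leq_b1 // big_ord1 coefC.
Qed.

Lemma skew_actXn P i (v : 'rV_(dim P)) :
  skew_act (skewX s ^+ i) v = iter i (@phi _ s P) v.
Proof.
by elim: i => [|i IH]; rewrite ?skew_act1 // exprS skew_actM skew_actX IH.
Qed.

Lemma skew_act0r P A : skew_act A (0 : 'rV_(dim P)) = 0.
Proof.
apply: big1 => i _; apply/eqP; rewrite scaler_eq0; apply/orP; right; apply/eqP.
by elim: (nat_of_ord i) => //= k ->; rewrite phi0.
Qed.

(** D_P is cyclic, generated by e_0. The row is e_0 written so that it also makes sense when P has
    degree 0 and D_P = 0. *)
Lemma iter_phi_delta P (i : 'I_(dim P)) :
  iter i (@phi _ s P) (\row_j (j == 0 :> nat)%:R) = delta_mx 0 i.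
Proof.
case: i => i; elim: i => [|i IH] lti /=.
  by apply/rowP => j; rewrite !mxE eqxx.
by rewrite (IH (ltnW lti)) (@phi_basis_lt _ s P _ (Ordinal lti)).
Qed.

Lemma skew_class_small P A : (sz A <= dim P)%N ->
  skew_class P A = poly_rV (A : {poly L}).
Proof.
move=> leA; rewrite /skew_class (skew_actE _ leA); apply/rowP => j.
rewrite summxE (bigD1 j) //= big1 => [|k neq_kj].
  by rewrite iter_phi_delta !mxE !eqxx mulr1 addr0.
by rewrite iter_phi_delta !mxE eq_sym (negPf neq_kj) mulr0.
Qed.

(** The defining value of [phi] on e_(d-1) says exactly that P annihilates e_0. *)
Lemma skew_class_self P : (P : {poly L}) \is monic -> skew_class P P = 0.
Proof.
move=> mP; have def_sz : sz P = (dim P).+1.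
  by rewrite prednK // size_poly_gt0 monic_neq0.
have [d0 | d_gt0] := posnP (dim P).
  by apply/rowP => j; have := ltn_ord j; rewrite [X in (_ < X)%N]d0.
have ltd : ((dim P).-1 < dim P)%N by rewrite prednK.
rewrite /skew_class (@skew_actE (dim P).+1); last by rewrite -def_sz.
rewrite big_ord_recr /=.
rewrite -/(lead_coef (P : {poly L})) (monicP mP) scale1r.
rewrite -[X in iter X _](prednK d_gt0) iterS (iter_phi_delta (Ordinal ltd)).
rewrite phi_basis_last /= ?prednK // -sumrB big1 // => j _.
by rewrite iter_phi_delta subrr.
Qed.

Lemma skew_classM P A B : skew_class P (A * B) = skew_act A (skew_class P B).
Proof. exact: skew_actM. Qed.

Lemma skew_classK P : cancel rVpoly (skew_class P).
Proof.
by move=> v; rewrite skew_class_small ?rVpolyK // size_poly.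
Qed.

(** Modulo P, A equals its remainder, whose coefficients are the coordinates of the class; so the
    class vanishes only with the remainder. *)
Lemma skew_class_eq0 P A : (P : {poly L}) \is monic ->
  skew_class P A = 0 <-> right_divides P A.
Proof.
move=> mP; split=> [|[U ->]]; last by rewrite skew_classM skew_class_self ?skew_act0r.
have [U [B [-> ltB]]] := skew_division A mP.
rewrite [LHS]skew_actDl -!/(skew_class _ _) skew_classM skew_class_self // skew_act0r add0r.
have leB: (sz B <= dim P)%N by rewrite -ltnS prednK // (leq_trans _ ltB).
rewrite skew_class_small // => /(congr1 rVpoly).
by rewrite poly_rV_K // raddf0 => ->; exists U; rewrite addr0.
Qed.

Lemma skew_class_eq P A B : (P : {poly L}) \is monic ->
  skew_class P A = skew_class P B <-> right_divides P (A - B).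
Proof.
move=> mP; have classB: skew_class P (A - B) = skew_class P A - skew_class P B.
  by rewrite /skew_class -[A in RHS](subrK B) (skew_actDl (A - B) B) addrK.
split=> [eqAB | /(skew_class_eq0 _ mP)/eqP].
  by apply/(skew_class_eq0 _ mP); rewrite classB eqAB subrr.
by rewrite classB subr_eq0 => /eqP.
Qed.

Lemma skew_class_linear P c A B :
  skew_class P (c *: (A : {poly L}) + B : {poly L})
    = c *: skew_class P A + skew_class P B.
Proof. by rewrite [LHS]skew_actDl [X in X + _]skew_actZl. Qed.

Lemma skew_class_rVpoly P A : (P : {poly L}) \is monic ->
  right_divides P ((rVpoly (skew_class P A) : skewpoly s) - A).
Proof. by move=> mP; apply/(skew_class_eq _ _ mP); rewrite skew_classK. Qed.

Lemma iter_phi_class P r A :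
  iter r (@phi _ s P) (skew_class P A) = skew_class P (skewX s ^+ r * A).
Proof. by rewrite skew_classM skew_actXn. Qed.

(** For P = U D there is an exact sequence 0 -> D_U -> D_P -> D_D -> 0, compatible with the action
    of X^r. *)
Lemma PsiM r U D P : iter r s =1 id -> (P : {poly L}) \is monic ->
    (D : {poly L}) \is monic -> P = U * D ->
  Psi r P = Psi r D * Psi r U.
Proof.
move=> sr mP mD defP.
have mU: (U : {poly L}) \is monic by apply: (monic_skew_mull mD); rewrite -defP.
have nzU: U != 0 by rewrite (monic_neq0 mU).
have phi_lin W : linear (iter r (@phi _ s W)) := iter_phi_linear sr.
(* [j] is right multiplication by D, [h] is reduction modulo D, and [g] is the linear section of [h]
   by representatives of low degree. *)
pose j (v : 'rV_(dim U)) := skew_class P ((rVpoly v : skewpoly s) * D).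
pose h (v : 'rV_(dim P)) := skew_class D (rVpoly v).
pose g (v : 'rV_(dim D)) := skew_class P (rVpoly v).
have j_lin: linear j.
  move=> c u v; rewrite /j linearP -skew_class_linear; congr (skew_class _ _).
  by rewrite [LHS]mulrDl; congr (_ + _); apply: skew_mulZl.
have h_lin: linear h by move=> c u v; rewrite /h linearP skew_class_linear.
have g_lin: linear g by move=> c u v; rewrite /g linearP skew_class_linear.
(* [j] and [h] do not depend on the representative, so both commute with left multiplication by
   X^r. *)
have jE A : j (skew_class U A) = skew_class P (A * D).
  apply/(skew_class_eq _ _ mP); have [W defA] := skew_class_rVpoly A mU.
  by exists W; rewrite -mulrBl defA -mulrA -defP.
have hE A : h (skew_class P A) = skew_class D A.
  apply/(skew_class_eq _ _ mD); have [W ->] := skew_class_rVpoly A mP.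
  by exists (W * U); rewrite defP mulrA.
rewrite /Psi; apply: (@char_poly_exact _ _ _ _ _ _ _
  (lin1_mx j) (lin1_mx h) (lin1_mx g)).
- have := size_skew_mul mD nzU; rewrite -defP => ->.
  have := size_poly_gt0 (U : {poly L}); rewrite (monic_neq0 mU).
  have := size_poly_gt0 (D : {poly L}); rewrite (monic_neq0 mD).
  by case: (sz U) => // m; case: (sz D) => //= n; rewrite addnS addnC.
- apply/row_matrixP => i; rewrite !rowE !mulmxA !linear_mul_lin1 //.
  rewrite -[delta_mx 0 i]skew_classK iter_phi_class !jE iter_phi_class.
  by rewrite mulrA.
- apply/row_matrixP => i; rewrite !rowE !mulmxA !linear_mul_lin1 //.
  by rewrite -[delta_mx 0 i]skew_classK iter_phi_class !hE iter_phi_class.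
- apply/row_matrixP => i; rewrite !rowE !mulmxA !linear_mul_lin1 // mulmx1.
  by rewrite hE skew_classK.
- rewrite -kermx_eq0; apply/rowV0P => v /sub_kermxP.
  rewrite linear_mul_lin1 // => /(skew_class_eq0 _ mP)[W].
  rewrite defP mulrA => /(skew_mulIm mD) defv.
  rewrite -[v]skew_classK; apply/(skew_class_eq0 _ mU).
  by exists W.
- apply/row_matrixP => i; rewrite row0 rowE !mulmxA !linear_mul_lin1 // hE.
  by apply/(skew_class_eq0 _ mD); exists (rVpoly (delta_mx 0 i)).
move=> v; rewrite linear_mul_lin1 // => /(skew_class_eq0 _ mD)[W defv].
apply/submxP; exists (skew_class U W).
by rewrite linear_mul_lin1 // jE -[LHS]skew_classK defv.
Qed.

Lemma size_Psi r P : size (Psi r P) = (dim P).+1.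
Proof. exact: size_char_poly. Qed.
End Action.

(** * Central elements q(X^r) and their action on D_P *)

Section Center.
Variables (F : finFieldType) (L : fieldExtType F).
Local Notation r := (\dim {:L}).
Implicit Types (p q : {poly F}) (A P D : skewpoly (frob L)).

Let f : {rmorphism F -> skewpoly (frob L)} := skewC (frob L) \o in_alg L.

Lemma skew_substE q : skew_subst L q r
  = \sum_(i < size q) skewC (frob L) (q`_i)%:A * skewX (frob L) ^+ (r * i).
Proof.
rewrite -[LHS]/((map_poly f q).[skewX (frob L) ^+ r]) horner_coef size_map_poly.
by apply: eq_bigr => i _; rewrite coef_map exprM.
Qed.

Lemma skewXnC n c : skewX (frob L) ^+ n * skewC (frob L) c
  = skewC (frob L) (iter n (frob L) c) * skewX (frob L) ^+ n.
Proof.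
elim: n => [|n IH]; first by rewrite mul1r mulr1.
by rewrite exprS -mulrA IH mulrA skewXC -mulrA.
Qed.

(** X^r commutes with constants because [frob] has r-th iterate the identity, and the coefficients
    of q commute with X because c^|F| = c on F. *)
Lemma skew_subst_central q A : GRing.comm (skew_subst L q r) A.
Proof.
have comm_mon c i : GRing.comm
    (skewC (frob L) c%:A * skewX (frob L) ^+ (r * i)) A.
  apply: commr_sym; rewrite [A]skewpolyE exprM; apply: commr_sym.
  apply: commr_sum => j _; apply: commrM; apply: commr_sym; apply: commrM.
  - by rewrite /GRing.comm -!rmorphM mulrC.
  - by apply/commrX; rewrite /GRing.comm skewXnC iter_frob.
  - apply/commr_sym/commrX; rewrite /GRing.comm skewXC; congr (skewC _ _ * _).
    by rewrite /= /frob -(rmorphXn (in_alg L)) expf_card.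
  - by rewrite /GRing.comm -exprM -!exprD addnC.
rewrite skew_substE; apply: commr_sym; apply: commr_sum => i _.
exact/commr_sym.
Qed.

(** Evaluation in a noncommutative ring respects a product once the value of the right factor
    commutes with the point; here that value is central. *)
Lemma skew_substM p q :
  skew_subst L (p * q) r = skew_subst L p r * skew_subst L q r.
Proof.
rewrite -[LHS]/((map_poly f _).[_]) rmorphM hornerM_comm //.
exact: esym (skew_subst_central q (skewX (frob L) ^+ r)).
Qed.

(** The bridge to linear algebra: X^r acts by the matrix of phi^r, so q(X^r) acts as q evaluated at
    it. *)
Lemma skew_act_subst q P (v : 'rV_(size (P : {poly L})).-1)
    (Q := map_poly (in_alg L) q) :
  skew_act (skew_subst L q r) v
    = \sum_(i < size Q) Q`_i *: iter i (mulmxr (lin1_mx (iter r (@phi _ _ P)))) v.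
Proof.
have actD := fun A B => skew_actDl A B v.
rewrite skew_substE (big_morph (fun A => skew_act A v) actD (skew_act0l v)).
rewrite size_map_poly; apply: eq_bigr => i _.
rewrite skew_actM skew_actC skew_actXn coef_map; congr (_ *: _).
elim: (nat_of_ord i) => [|n IH]; first by rewrite muln0.
rewrite mulnS iterD IH iterS /= linear_mul_lin1 //.
exact: iter_phi_linear (@iter_frob F L).
Qed.

(** Cayley-Hamilton for phi^r, applied to e_0. *)
Lemma right_divides_subst_Psi P q : (P : {poly L}) \is monic ->
  Psi r P = map_poly (in_alg L) q -> right_divides P (skew_subst L q r).
Proof.
move=> mP PsiP; apply/(skew_class_eq0 _ mP).
rewrite /skew_class skew_act_subst -PsiP.
exact: char_poly_annihilates.
Qed.

(** By centrality q(X^r) A = A q(X^r) is a left multiple of P for every A, so q(phi^r) kills all of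
    D_P and not only e_0. *)
Lemma Psi_dvd_exp P q : (P : {poly L}) \is monic ->
    right_divides P (skew_subst L q r) ->
  Psi r P %| map_poly (in_alg L) q ^+ (size (P : {poly L})).-1.
Proof.
move=> mP [U defq]; apply: char_poly_dvd_exp => v.
rewrite -skew_act_subst -[v]skew_classK -skew_classM.
apply/(skew_class_eq0 _ mP).
rewrite skew_subst_central defq; exists ((rVpoly v : skewpoly (frob L)) * U).
by rewrite mulrA.
Qed.
End Center.

(** * The right-divisor attached to one irreducible factor *)

Theorem proposition2p4p11 (p a r s : nat) (F : finFieldType)
    (L : fieldExtType F) (hp : prime p) (hF : #|F| = (p ^ a)%N)
    (hL : \dim {:L} = r)
    (P : skewpoly (frob L)) (P_monic : (P : {poly L}) \is monic)
    (Q : 'I_s -> {poly F})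
    (Q_monic : forall i, Q i \is monic)
    (Q_irr : forall i, irreducible_poly (Q i))
    (Q_inj : injective Q)
    (hPsi : Psi r P = map_poly (in_alg L) (\prod_(i < s) Q i))
    (i : 'I_s) :
  exists Pi : skewpoly (frob L),
    unique (fun D : skewpoly (frob L) =>
              [/\ (D : {poly L}) \is monic, right_divides D P
                & Psi r D = map_poly (in_alg L) (Q i)]) Pi
    /\ is_rgcd Pi P (skew_subst L (Q i) r).
Proof.
subst r; set r := \dim {:L} in hPsi *.
move: hPsi; rewrite (bigD1 i) //=; set N := \prod_(_ < _ | _) _ => hPsi.
have coQN: coprimep (Q i) N.
  rewrite /N; elim/big_rec: _ => [|j M neq_ji]; first exact: coprimep1.
  rewrite coprimepMr => ->; rewrite andbT irreducible_poly_coprime //.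
  apply: contra neq_ji => /(apply_irredp (Q_irr j)).
  have [/ltn_eqF szQ _] := Q_irr i; rewrite eq_sym szQ => /(_ isT).
  by rewrite eqp_monic // => /eqP/Q_inj ->.
set Z := skew_subst L (Q i) r.
have [D [mD [U defP] [V defZ] [A [B defD]]]] := skew_bezout Z P_monic.
have mU: (U : {poly L}) \is monic by apply: (monic_skew_mull mD); rewrite -defP.
have rgcdD: is_rgcd D P Z.
  split=> //; [by exists U | by exists V |].
  move=> C [M eqP] [M' eqZ]; exists (A * M + B * M').
  by rewrite mulrDl -!mulrA -eqP -eqZ.
have PsiP: Psi r P = Psi r D * Psi r U.
  exact: PsiM (@iter_frob F L) P_monic mD defP.
have UdivN: right_divides U (skew_subst L N r).
  have [W defPsi] := right_divides_subst_Psi P_monic hPsi.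
  have [X defX]: exists X, skew_subst L N r * D = X * P.
    (* Multiply D = A P + B Z by the central N(X^r) and use N(X^r) Z = W P, which is Cayley-Hamilton
       for P. *)
    exists (skew_subst L N r * A + B * W).
    rewrite defD mulrDr mulrDl !mulrA; congr (_ + _).
    rewrite -[RHS]mulrA -defPsi skew_substM (skew_subst_central N B).
    by rewrite (skew_subst_central (Q i)) mulrA.
  by exists X; apply: (skew_mulIm mD); rewrite -mulrA -defP.
have PsiD: Psi r D = map_poly (in_alg L) (Q i).
  (* Mutual divisibility by Gauss: [Psi r D] is coprime to N, [Q i] is coprime to [Psi r U], and
     both products equal [Psi r P]. *)
  apply/eqP; rewrite -eqp_monic ?char_poly_monic ?map_monic //.
  rewrite rmorphM /= in hPsi; apply/andP; split.
    have coDN: coprimep (Psi r D) (map_poly (in_alg L) N).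
      have dvdD: Psi r D %| _ := Psi_dvd_exp mD (ex_intro _ V defZ).
      apply: coprimep_dvdr dvdD _; apply: coprimep_expl.
      by rewrite coprimep_map.
    by rewrite -(Gauss_dvdpl _ coDN) -hPsi PsiP dvdp_mulr.
  have coQU: coprimep (map_poly (in_alg L) (Q i)) (Psi r U).
    apply: coprimep_dvdl (Psi_dvd_exp mU UdivN) _; apply: coprimep_expr.
    by rewrite coprimep_map.
  by rewrite -(Gauss_dvdpl _ coQU) -PsiP hPsi dvdp_mulr.
exists D; split=> //; split; first by split=> //; exists U.
move=> D' [mD' D'P PsiD'].
have [_ _ _ /(_ D' D'P)] := rgcdD.
case=> [|C defDD']; first exact: right_divides_subst_Psi mD' PsiD'.
have mC: (C : {poly L}) \is monic.
  by apply: (monic_skew_mull mD'); rewrite -defDD'.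
have nzC: C != 0 by rewrite (monic_neq0 mC).
(* The degree of a skew polynomial is that of its [Psi], so D and D' have equal degree and the monic
   cofactor C must be 1. *)
have eq_sz: size (D : {poly L}) = size (D' : {poly L}).
  rewrite -[LHS]prednK ?size_poly_gt0 ?monic_neq0 // -(size_Psi r D) PsiD -PsiD'.
  by rewrite size_Psi prednK // size_poly_gt0 monic_neq0.
have szC: size (C : {poly L}) = 1%N.
  have := size_skew_mul mD' nzC; rewrite -defDD' eq_sz => /eqP.
  have := size_poly_gt0 (D' : {poly L}); rewrite (monic_neq0 mD').
  have := size_poly_gt0 (C : {poly L}); rewrite (monic_neq0 mC).
  case: (size (C : {poly L})) => // m _; rewrite addSn /= -{2}[size _]add0n.
  by rewrite eqn_add2r => _ /eqP <-.
have [c _ defC] := size_poly1P _ (introT eqP szC).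
have c1: c = 1.
  by move: mC; rewrite defC monicE lead_coefC => /eqP.
by rewrite defDD' defC c1 mul1r.
Qed.
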